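(* Every output $(Q,c)$ of Algorithm 3 (described in the context) belongs to $\mathcal{E}_{RS}$. Conversely, any $(Q,c)\in\mathcal{E}_{RS}$ can be generated by Algorithm 3 with appropriate choices of $\hat x\in F$ and $(\hat u,\hat v,\hat W,\hat Y,\hat Z,\hat\beta,\hat h,\hat H)\in\mathbb{R}^n\times\mathbb{R}^n\times\mathcal{S}^n\times\mathbb{R}^{n\times n}\times\mathcal{S}^n\times\mathbb{R}\times\mathbb{R}^n\times\mathcal{S}^n$.
   Context: Let $n \ge 1$, let $\mathcal{S}^n$ be the space of real symmetric $n\times n$ matrices, $e \in \mathbb{R}^n$ the all-ones vector, $\langle A,B\rangle = \mathrm{trace}(A^TB)$; inequalities $\ge,\le$ on vectors and matrices are componentwise, and $A\succeq0$ means positive semidefinite. For index sets $\mathbb{J},\mathbb{K}$, $x_{\mathbb{K}}$ is the subvector of $x$ indexed by $\mathbb{K}$ and $B_{\mathbb{J}\mathbb{K}}$ (or $B_{\mathbb{J},\mathbb{K}}$) the submatrix of $B$ with rows in $\mathbb{J}$ and columns in $\mathbb{K}$. For $(Q,c) \in \mathcal{S}^n\times\mathbb{R}^n$ let $q(x) = \frac12 x^TQx + c^Tx$, $F = \{x \in \mathbb{R}^n : 0 \le x \le e\}$, $\ell^* = \min_{x\in F} q(x)$ (the problem (BoxQP)). Let $$\mathcal{F}_R = \{(x,X)\in\mathbb{R}^n\times\mathcal{S}^n : 0\le x\le e,\ \max\{x_i+x_j-1,0\}\le X_{ij}\le \min\{x_i,x_j\},\ 1\le i\le j\le n\},$$ $\mathcal{F}_{RS}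 = \{(x,X)\in\mathcal{F}_R : X-xx^T\succeq0\}$, $\ell^*_{RS}=\min\{\frac12\langle Q,X\rangle+c^Tx : (x,X)\in\mathcal{F}_{RS}\}$ (the SDP-RLT relaxation), and $\mathcal{E}_{RS}=\{(Q,c)\in\mathcal{S}^n\times\mathbb{R}^n : \ell^*=\ell^*_{RS}\}$. Algorithm 3. Input: $n$ and $\hat x\in F$. Set $\mathbb{L}=\{j:\hat x_j=0\}$, $\mathbb{B}=\{j:0<\hat x_j<1\}$, $\mathbb{U}=\{j:\hat x_j=1\}$. Choose arbitrary: $\hat u\in\mathbb{R}^n$ with $\hat u_{\mathbb{U}}\ge0$, $\hat u_{\mathbb{L}\cup\mathbb{B}}=0$; $\hat v\in\mathbb{R}^n$ with $\hat v_{\mathbb{L}}\ge0$, $\hat v_{\mathbb{B}\cup\mathbb{U}}=0$; $\hat W\in\mathcal{S}^n$ with $\hat W_{\mathbb{B}\cup\mathbb{L},\mathbb{B}\cup\mathbb{L}}=0$ and $\hat W_{ij}\ge0$ otherwise; $\hat Y\in\mathbb{R}^{n\times n}$ with $\hat Y_{\mathbb{L}\mathbb{B}}=0$, $\hat Y_{\mathbb{L}\mathbb{U}}=0$, $\hat Y_{\mathbb{B}\mathbb{B}}=0$, $\hat Y_{\mathbb{B}\mathbb{U}}=0$ and $\hat Y_{ij}\ge0$ otherwise; $\hat Z\in\mathcal{S}^n$ with $\hat Z_{\mathbb{B}\cup\mathbb{U},\mathbb{B}\cup\mathbb{U}}=0$ and $\hat Z_{ij}\ge0$ otherwise; $\hat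 H\in\mathcal{S}^n$ with $\hat H\succeq0$. Set $\hat h=-\hat H\hat x$, $\hat\beta=-\hat h^T\hat x$. Output $(Q,c)$ with $Q=\hat W-\hat Y-\hat Y^T+\hat Z+\hat H$ and $c=-\hat u+\hat v-\hat We+\hat Y^Te+\hat h$. *)

(* Defs.v *)
From HB Require Import structures.
From mathcomp Require Import all_boot all_order all_algebra.
From mathcomp Require Import all_classical all_reals all_analysis.

Set Implicit Arguments.
Unset Strict Implicit.
Unset Printing Implicit Defensive.

Import Order.TTheory GRing.Theory Num.Theory.
Import numFieldNormedType.Exports.

Local Open Scope classical_set_scope.
Local Open Scope ring_scope.

Section BoxQP.
Variables (R : realType) (n : nat).
Implicit Types (x u v c h : 'cV[R]_n) (Q X W Y Z H : 'M[R]_n).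

Definition ones : 'cV[R]_n := const_mx 1.

Definition symmetric_mx (A : 'M[R]_n) : Prop := A^T = A.

(* Symmetry is not part of [psd]; it is always stated separately. *)
Definition psd (A : 'M[R]_n) : Prop :=
  forall z : 'cV[R]_n, 0 <= (z^T *m A *m z) 0 0.

Definition mxdot (m k : nat) (A B : 'M[R]_(m, k)) : R := \tr (A^T *m B).

Definition box_qp_obj Q c x : R :=
  2^-1 * (x^T *m Q *m x) 0 0 + (c^T *m x) 0 0.

Definition box : set 'cV[R]_n := [set x | forall i, 0 <= x i 0 <= 1].

(* The minimum is written as an infimum; [ell_star_min] below shows that it is
   attained. *)
Definition ell_star Q c : R := inf [set box_qp_obj Q c x | x in box].

Definition F_R : set ('cV[R]_n * 'M[R]_n) :=
  [set p | [/\ box p.1, symmetric_mx p.2 &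
     forall i j : 'I_n, (i <= j)%N ->
       Num.max (p.1 i 0 + p.1 j 0 - 1) 0 <= p.2 i j
         <= Num.min (p.1 i 0) (p.1 j 0)]].

Definition F_RS : set ('cV[R]_n * 'M[R]_n) :=
  [set p | F_R p /\ psd (p.2 - p.1 *m p.1^T)].

Definition lifted_obj Q c (p : 'cV[R]_n * 'M[R]_n) : R :=
  2^-1 * mxdot Q p.2 + (c^T *m p.1) 0 0.

(* Attained as well, see [ell_RS_min]. *)
Definition ell_RS Q c : R := inf [set lifted_obj Q c p | p in F_RS].

Definition E_RS : set ('M[R]_n * 'cV[R]_n) :=
  [set Qc | symmetric_mx Qc.1 /\ ell_star Qc.1 Qc.2 = ell_RS Qc.1 Qc.2].

(* For [x] in the box these three sets partition the indices, so that being
   outside two of them means being in the third. *)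
Definition idxL x : {set 'I_n} := [set j | x j 0 == 0]%SET.
Definition idxB x : {set 'I_n} := [set j | 0 < x j 0 < 1]%SET.
Definition idxU x : {set 'I_n} := [set j | x j 0 == 1]%SET.

Definition vzero_on_ge0_off (J : {set 'I_n}) (w : 'cV[R]_n) : Prop :=
  forall j, if j \in J then w j 0 = 0 else 0 <= w j 0.

Definition mzero_on_ge0_off (S : {set 'I_n * 'I_n}) (A : 'M[R]_n) : Prop :=
  forall i j, if (i, j) \in S then A i j = 0 else 0 <= A i j.

Record algorithm3_choice x u v W Y Z (beta : R) h H : Prop := Algorithm3Choice {
  alg3_x : box x;
  alg3_u : vzero_on_ge0_off (idxL x :|: idxB x)%SET u;
  alg3_v : vzero_on_ge0_off (idxB x :|: idxU x)%SET v;
  alg3_W_sym : symmetric_mx W;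
  alg3_W : mzero_on_ge0_off
    (finset.setX (idxB x :|: idxL x) (idxB x :|: idxL x))%SET W;
  alg3_Y : mzero_on_ge0_off
    (finset.setX (idxL x) (idxB x) :|: finset.setX (idxL x) (idxU x)
     :|: finset.setX (idxB x) (idxB x) :|: finset.setX (idxB x) (idxU x))%SET Y;
  alg3_Z_sym : symmetric_mx Z;
  alg3_Z : mzero_on_ge0_off
    (finset.setX (idxB x :|: idxU x) (idxB x :|: idxU x))%SET Z;
  alg3_H_sym : symmetric_mx H;
  alg3_H : psd H;
  alg3_h : h = - (H *m x);
  alg3_beta : beta = - (h^T *m x) 0 0
}.

Definition algorithm3_Q W Y Z H : 'M[R]_n := W - Y - Y^T + Z + H.

Definition algorithm3_c u v W Y h : 'cV[R]_n :=
  - u + v - W *m ones + Y^T *m ones + h.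

Definition algorithm3 x u v W Y Z (beta : R) h H
    (out : 'M[R]_n * 'cV[R]_n) : Prop :=
  algorithm3_choice x u v W Y Z beta h H /\
  out = (algorithm3_Q W Y Z H, algorithm3_c u v W Y h).

End BoxQP.

Section Attainment.
Variables (R : realType) (n : nat).

Lemma inf_image_attained (T : Type) (A : set T) (f : T -> R) (a : T) :
  A a -> (forall b, A b -> f a <= f b) -> inf [set f b | b in A] = f a.
Proof.
move=> Aa fa; apply/eqP; rewrite eq_le; apply/andP; split.
- apply: ge_inf; last by exists a.
  by exists (f a) => _ [b Ab <-]; exact: fa.
- apply: lb_le_inf; first by exists (f a), a.
  by move=> _ [b Ab <-]; exact: fa.
Qed.

Let coordc m (i : 'I_m) : continuous (fun p : 'rV[R]_m => p 0 i).
Proof. exact: coord_continuous. Qed.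

Let contD m (f g : 'rV[R]_m -> R) :
  continuous f -> continuous g -> continuous (fun p => f p + g p).
Proof. by move=> cf cg p; exact: (@continuousD R R^o _ f g p (cf p) (cg p)). Qed.

Let contM m (f g : 'rV[R]_m -> R) :
  continuous f -> continuous g -> continuous (fun p => f p * g p).
Proof. by move=> cf cg p; exact: (@continuousM R _ f g p (cf p) (cg p)). Qed.

Let contN m (f : 'rV[R]_m -> R) : continuous f -> continuous (fun p => - f p).
Proof. by move=> cf p; exact: (@continuousN R R^o _ f p (cf p)). Qed.

Let contK m (a : R) : continuous (fun p : 'rV[R]_m => a).
Proof. exact: cst_continuous. Qed.

Let contS m k (f : 'I_k -> 'rV[R]_m -> R) :
  (forall i, continuous (f i)) -> continuous (fun p => \sum_i f i p).
Proof.
elim: k f => [|k IH] f cf.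
  by under eq_fun => p do rewrite big_ord0; exact: contK.
under eq_fun => p do rewrite big_ord_recr /=.
by apply: contD => //; exact: IH.
Qed.

Let closed_ge0 m (f : 'rV[R]_m -> R) :
  continuous f -> closed [set p | 0 <= f p].
Proof.
move=> cf; apply: (preimage_closed _ (@closed_ge R 0)) => p _; exact: cf.
Qed.

Let closed_all m (I : Type) (P : I -> 'rV[R]_m -> Prop) :
  (forall i, closed [set p | P i p]) -> closed [set p | forall i, P i p].
Proof.
move=> cP; rewrite (_ : [set p | _] = \bigcap_(i in setT) [set p | P i p]).
  by apply: closed_bigI => i _; exact: cP.
by apply/seteqP; split=> p Pp i => [_|]; apply: Pp.
Qed.

Let mulmxE' (A : 'M[R]_n) (z : 'cV[R]_n) :
  (z^T *m A *m z) 0 0 = \sum_j (\sum_i z i 0 * A i j) * z j 0.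
Proof.
rewrite !mxE; apply: eq_bigr => j _; rewrite !mxE; congr (_ * _).
by apply: eq_bigr => i _; rewrite !mxE.
Qed.

Let EVT_box m (A : set 'rV[R]_m) (f : 'rV[R]_m -> R) :
  A !=set0 -> closed A -> (forall p, A p -> forall i, 0 <= p 0 i <= 1) ->
  continuous f -> exists2 p, A p & forall q, A q -> f p <= f q.
Proof.
move=> A0 cA Ab cf.
have cb : compact [set p : 'rV[R]_m | forall i, `[(0:R), 1]%classic (p 0 i)].
  by apply: (@rV_compact _ _ (fun=> `[(0:R), 1]%classic)) => _;
     exact: segment_compact.
have kA : compact A.
  apply: (subclosed_compact cA cb) => p /Ab + i => /(_ i).
  by rewrite /= in_itv.
have cfA : {within A, continuous f} by exact: continuous_subspaceT.
have [p pA pm] := EVT_min_rV A0 kA cfA.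
by exists p; [exact/set_mem|move=> q /mem_set; exact: pm].
Qed.

Theorem ell_star_min (Q : 'M[R]_n) (c : 'cV[R]_n) :
  exists2 x, box x & ell_star Q c = box_qp_obj Q c x /\
    (forall y, box y -> ell_star Q c <= box_qp_obj Q c y).
Proof.
have [||//||p pA pm] := @EVT_box n [set p | forall i, 0 <= p 0 i <= 1]
    (fun p => box_qp_obj Q c p^T).
- by exists 0 => i; rewrite mxE lexx ler01.
- apply: closed_all => i.
  rewrite (_ : [set p | _] = [set p : 'rV[R]_n | 0 <= p 0 i] `&`
                             [set p | 0 <= 1 + - p 0 i]).
    apply: closedI; apply: closed_ge0; first exact: coordc.
    by apply: contD; [exact: contK|apply: contN; exact: coordc].
  by apply/seteqP; split=> p /=; rewrite subr_ge0 => /andP.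
- rewrite /box_qp_obj.
  under eq_fun => p do rewrite mulmxE' [X in _ + X]mxE.
  apply: contD; last first.
    apply: contS => i; apply: contM; first exact: contK.
    by under eq_fun => p do rewrite mxE; exact: coordc.
  apply: contM; first exact: contK.
  apply: contS => j; apply: contM; last first.
    by under eq_fun => p do rewrite mxE; exact: coordc.
  apply: contS => i; apply: contM; last exact: contK.
  by under eq_fun => p do rewrite mxE; exact: coordc.
- have bp : box p^T by move=> i; rewrite mxE.
  have lep y : box y -> box_qp_obj Q c p^T <= box_qp_obj Q c y.
    by move=> yb; rewrite -[y]trmxK; apply: pm => i; rewrite mxE.
  have E := inf_image_attained bp lep.
  by exists p^T => //; rewrite /ell_star E.
Qed.

Let dec (p : 'rV[R]_(n + n * n)) : 'cV[R]_n * 'M[R]_n :=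
  ((lsubmx p)^T, vec_mx (rsubmx p)).

Let enc (s : 'cV[R]_n * 'M[R]_n) : 'rV[R]_(n + n * n) :=
  row_mx s.1^T (mxvec s.2).

Let encK s : dec (enc s) = s.
Proof. by case: s => x X; rewrite /dec row_mxKl row_mxKr trmxK mxvecK. Qed.

Let dec1 i : continuous (fun p => (dec p).1 i 0).
Proof. by under eq_fun => p do rewrite !mxE; exact: coordc. Qed.

Let dec2 i j : continuous (fun p => (dec p).2 i j).
Proof. by under eq_fun => p do rewrite !mxE; exact: coordc. Qed.

Theorem ell_RS_min (Q : 'M[R]_n) (c : 'cV[R]_n) :
  exists2 p, F_RS p & ell_RS Q c = lifted_obj Q c p /\
    (forall s, F_RS s -> ell_RS Q c <= lifted_obj Q c s).
Proof.
have [||||p pA pm] := @EVT_box (n + n * n) [set p | F_RS (dec p)]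
    (fun p => lifted_obj Q c (dec p)).
- exists (enc (0, 0)); rewrite /= encK; split; first split => /=.
  + by move=> i; rewrite mxE lexx ler01.
  + by rewrite /symmetric_mx trmx0.
  + by move=> i j _; rewrite !mxE add0r sub0r minxx ge_max lexx lerN10.
  + by move=> z; rewrite /= mul0mx subr0 mulmx0 mul0mx mxE.
- pose G (k : 'I_n * 'I_n) (p : 'rV[R]_(n + n * n)) : Prop :=
    [/\ 0 <= (dec p).1 k.1 0, 0 <= 1 + - (dec p).1 k.1 0,
        0 <= (dec p).2 k.1 k.2 + - (dec p).2 k.2 k.1 &
        (k.1 <= k.2)%N ->
        [/\ 0 <= (dec p).2 k.1 k.2 + - ((dec p).1 k.1 0 + (dec p).1 k.2 0 + -1),
            0 <= (dec p).2 k.1 k.2,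
            0 <= (dec p).1 k.1 0 + - (dec p).2 k.1 k.2 &
            0 <= (dec p).1 k.2 0 + - (dec p).2 k.1 k.2]].
  rewrite (_ : [set p | _] = [set p | forall k, G k p] `&`
    [set p | forall z : 'cV[R]_n, 0 <= \sum_j (\sum_i z i 0 *
        ((dec p).2 i j + - ((dec p).1 i 0 * (dec p).1 j 0))) * z j 0]).
    apply: closedI; last first.
      apply: closed_all => z; apply: closed_ge0.
      apply: contS => j; apply: contM; last exact: contK.
      apply: contS => i; apply: contM; first exact: contK.
      by apply: contD; [exact: dec2|apply: contN; apply: contM; exact: dec1].
    apply: closed_all => k.
    have c1 := closed_ge0 (@dec1 k.1).
    have c2 := closed_ge0 (contD (@contK _ 1) (contN (@dec1 k.1))).
    have c3 := closed_ge0 (contD (@dec2 k.1 k.2) (contN (@dec2 k.2 k.1))).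
    have c4 := closed_ge0 (contD (@dec2 k.1 k.2) (contN (contD (contD
                 (@dec1 k.1) (@dec1 k.2)) (@contK _ (-1))))).
    have c5 := closed_ge0 (@dec2 k.1 k.2).
    have c6 := closed_ge0 (contD (@dec1 k.1) (contN (@dec2 k.1 k.2))).
    have c7 := closed_ge0 (contD (@dec1 k.2) (contN (@dec2 k.1 k.2))).
    have [kk|kk] := leqP k.1 k.2.
      have := closedI c1 (closedI c2 (closedI c3 (closedI c4 (closedI c5
        (closedI c6 c7))))).
      congr closed; apply/seteqP; split=> p.
        by move=> [? [? [? [? [? []]]]]].
      by move=> [? ? ? /(_ kk)[]].
    have := closedI c1 (closedI c2 c3).
    congr closed; apply/seteqP; split=> p.
      move=> [? []]; split => // kk'.
      by move: kk; rewrite ltnNge kk'.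
    by move=> [? ? ?].
  have psdE p : psd ((dec p).2 - (dec p).1 *m (dec p).1^T) <->
      (forall z : 'cV[R]_n, 0 <= \sum_j (\sum_i z i 0 *
        ((dec p).2 i j + - ((dec p).1 i 0 * (dec p).1 j 0))) * z j 0).
    have E (z : 'cV[R]_n) :
      (z^T *m ((dec p).2 - (dec p).1 *m (dec p).1^T) *m z) 0 0 =
      \sum_j (\sum_i z i 0 *
        ((dec p).2 i j + - ((dec p).1 i 0 * (dec p).1 j 0))) * z j 0.
      rewrite mulmxE'; apply: eq_bigr => j _; congr (_ * _).
      apply: eq_bigr => i _; congr (_ * _).
      move: (dec p) => [y Y] /=.
      by rewrite !mxE big_ord1 !mxE.
    by split=> h z; [rewrite -E|rewrite E]; exact: h.
  apply/seteqP; split=> p.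
    move=> [[xb Xs Xb] /psdE Xp]; split => // -[i j]; rewrite /G /=.
    have /andP[xi0 xi1] := xb i.
    have -> : (dec p).2 j i = (dec p).2 i j by rewrite -{1}Xs mxE.
    rewrite subrr !subr_ge0; split => // /Xb.
    by rewrite ge_max le_min => /andP[/andP[? ?] /andP[? ?]]; split.
  move=> [Gp /psdE Xp]; split => //; split.
  + move=> i; have [? + _ _] := Gp (i, i).
    by rewrite subr_ge0 /= => ->; apply/andP; split.
  + apply/matrixP => i j; rewrite [LHS]mxE; apply/eqP; rewrite eq_le.
    have [_ _ + _] := Gp (i, j); have [_ _ + _] := Gp (j, i).
    by rewrite !subr_ge0 /= => -> ->.
  + move=> i j ij; have [_ _ _ /(_ ij)[]] := Gp (i, j).
    by rewrite !subr_ge0 /= ge_max le_min => -> -> -> ->.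
- move=> p [[xb Xs Xb] _] k.
  have [i ->|k' ->] := split_ordP k.
    by have := xb i; rewrite !mxE.
  case/mxvec_indexP: k' => i j.
  have -> : p 0 (rshift n (mxvec_index i j)) = (dec p).2 i j by rewrite !mxE.
  have H (i' j' : 'I_n) : (i' <= j')%N -> 0 <= (dec p).2 i' j' <= 1.
    move=> /Xb; rewrite ge_max le_min => /andP[/andP[_ ->] /andP[+ _]] /=.
    by move=> /le_trans; apply; have /andP[] := xb i'.
  have [/H //|/ltnW/H] := leqP i j.
  by rewrite -{1 2}Xs mxE.
- rewrite /lifted_obj /mxdot /mxtrace.
  apply: contD.
    apply: contM; first exact: contK.
    apply: contS => i; under eq_fun => p do rewrite mxE.
    by apply: contS => j; apply: contM; [exact: contK|exact: dec2].
  under eq_fun => p do rewrite mxE.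
  by apply: contS => j; apply: contM; [exact: contK|exact: dec1].
- have les s : F_RS s -> lifted_obj Q c (dec p) <= lifted_obj Q c s.
    by move=> Fs; rewrite -[s]encK; apply: pm; rewrite /= encK.
  have E := inf_image_attained (A := @F_RS R n) pA les.
  by exists (dec p) => //; rewrite /ell_RS E.
Qed.

End Attainment.

(* Main.v *)
Require Import Defs.
From HB Require Import structures.
From mathcomp Require Import all_boot all_order all_algebra.
From mathcomp Require Import all_classical all_reals all_analysis.
From mathcomp Require Import ring lra.

Set Implicit Arguments.
Unset Strict Implicit.
Unset Printing Implicit Defensive.

Import Order.TTheory GRing.Theory Num.Theory.
Import numFieldNormedType.Exports.

Local Open Scope classical_set_scope.
Local Open Scope ring_scope.

(** Why the theorem holds.  Write [x] and [X] as the symmetric matrix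
    [M = [1 x^T; x X]] of order [1 + n] ([lift_mx]).  Then [X - x x^T >= 0] says
    that [M] is positive semidefinite, and the RLT inequalities say that
    [G M G^T] is entrywise nonnegative, where the [2n] rows of [G] ([facet_mx])
    are the affine forms [x_i] and [1 - x_i]: every RLT inequality is the
    linearised product of two of them.  The bounds [0 <= x <= e] follow from the
    RLT inequalities with [i = j].  The relaxation is thus a semidefinite
    program, homogeneous in [M] apart from the corner entry, and its dual
    certificates are the identities
      [[-2 ell c^T; c Q] = G^T L G + K], with [L >= 0] and [K] psd.
    Splitting [L = [Z Y^T; Y W]] and [K = [beta h^T; h H]] into blocks gives
    precisely the formulas for [Q] and [c] in the algorithm, with [u = v = 0]
    ([dual_lift]).  A certificate is tight at the rank-one point
    [M = v v^T], [v = (1, x)], exactly when [L] vanishes against [G M G^T] entry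
    by entry, which is the sparsity pattern imposed on [W], [Y], [Z]
    ([slack_rank1P]), and when [K v = 0], which is the choice of [h] and [beta].

    Soundness is weak duality: an output of the algorithm is a certificate, up
    to the terms in [u] and [v] that [x] also minimises over the box, so [x x^T]
    is optimal for the relaxation ([algorithm3_sound]).  It uses that the trace
    product of two psd matrices is nonnegative ([psd_mxdot_ge0]).

    Completeness is strong duality with an attained dual.  If the relaxation is
    exact, then its value is attained at [x x^T] with [x] a minimiser over the
    box.  The nonnegativity of the objective minus its minimum on the feasible
    cone ([lifted_obj_ge0_on_cone]) yields a certificate by [sdp_farkas], and it
    is tight at [x x^T].  Such a converse needs the cone of certificates to be
    closed, which is ensured by the strictly feasible point
    [slater_mx]: it bounds the multipliers, so that a nearest point of that cone
    exists by compactness ([conic_farkas]). *)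

(** * The trace inner product *)

Section TraceInnerProduct.
Variable R : realType.

Lemma mxdotE m k (A B : 'M[R]_(m, k)) :
  mxdot A B = \sum_i \sum_j A i j * B i j.
Proof.
rewrite /mxdot /mxtrace exchange_big /=; apply: eq_bigr => j _.
by rewrite !mxE; apply: eq_bigr => i _; rewrite !mxE.
Qed.

Lemma mxdotC m k (A B : 'M[R]_(m, k)) : mxdot A B = mxdot B A.
Proof.
by rewrite !mxdotE; apply: eq_bigr => i _; apply: eq_bigr => j _; rewrite mulrC.
Qed.

Lemma mxdotDr m k (A B C : 'M[R]_(m, k)) :
  mxdot A (B + C) = mxdot A B + mxdot A C.
Proof. by rewrite /mxdot mulmxDr mxtraceD. Qed.

Lemma mxdotDl m k (A B C : 'M[R]_(m, k)) :
  mxdot (A + B) C = mxdot A C + mxdot B C.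
Proof. by rewrite mxdotC mxdotDr !(mxdotC C). Qed.

Lemma mxdotZr m k a (A B : 'M[R]_(m, k)) : mxdot A (a *: B) = a * mxdot A B.
Proof. by rewrite /mxdot -scalemxAr mxtraceZ. Qed.

Lemma mxdotZl m k a (A B : 'M[R]_(m, k)) : mxdot (a *: A) B = a * mxdot A B.
Proof. by rewrite mxdotC mxdotZr mxdotC. Qed.

Lemma mxdotNr m k (A B : 'M[R]_(m, k)) : mxdot A (- B) = - mxdot A B.
Proof. by rewrite -scaleN1r mxdotZr mulN1r. Qed.

Lemma mxdotNl m k (A B : 'M[R]_(m, k)) : mxdot (- A) B = - mxdot A B.
Proof. by rewrite mxdotC mxdotNr mxdotC. Qed.

Lemma mxdotBl m k (A B C : 'M[R]_(m, k)) :
  mxdot (A - B) C = mxdot A C - mxdot B C.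
Proof. by rewrite mxdotDl mxdotNl. Qed.

Lemma mxdotBr m k (A B C : 'M[R]_(m, k)) :
  mxdot A (B - C) = mxdot A B - mxdot A C.
Proof. by rewrite mxdotDr mxdotNr. Qed.

Lemma mxdot_ge0 m k (A : 'M[R]_(m, k)) : 0 <= mxdot A A.
Proof.
rewrite mxdotE; do 2!apply: sumr_ge0 => ? _.
by rewrite -expr2 sqr_ge0.
Qed.

Lemma mxdot_eq0 m k (A : 'M[R]_(m, k)) : mxdot A A <= 0 -> A = 0.
Proof.
move=> A0; have /eqP : mxdot A A = 0 by apply/eqP; rewrite eq_le A0 mxdot_ge0.
rewrite mxdotE psumr_eq0; last first.
  by move=> i _; apply: sumr_ge0 => j _; rewrite -expr2 sqr_ge0.
move=> /allP Ai; apply/matrixP => i j; rewrite mxE.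
have /= := Ai i (mem_index_enum _); rewrite psumr_eq0; last first.
  by move=> k' _; rewrite -expr2 sqr_ge0.
move=> /allP/(_ j (mem_index_enum _)) /=.
by rewrite mulf_eq0 orbb => /eqP.
Qed.

Lemma mxdot_congr m k (G : 'M[R]_(m, k)) (L : 'M[R]_m) (M : 'M[R]_k) :
  mxdot (G^T *m L *m G) M = mxdot L (G *m M *m G^T).
Proof.
by rewrite /mxdot !trmx_mul trmxK -!mulmxA mxtrace_mulC -!mulmxA.
Qed.

Lemma mxdot_rank1 k (A : 'M[R]_k) (z : 'cV[R]_k) :
  mxdot A (z *m z^T) = (z^T *m A *m z) 0 0.
Proof.
rewrite mxdotC /mxdot trmx_mul trmxK mxtrace_mulC mulmxA.
by rewrite mxtrace_mulC mulmxA trace_mx11.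
Qed.

End TraceInnerProduct.

(** * Duality for closed convex cones *)

Section ConicFarkas.
Variable R : realType.

Lemma scalar_rV_continuous N (f : 'rV[R]_N -> R) : scalar f -> continuous f.
Proof.
move=> flin.
pose g : {scalar 'rV[R]_N} := HB.pack f (GRing.isLinear.Build _ _ _ _ _ flin).
have -> : f = fun k => \sum_i k 0 i * f (delta_mx 0 i).
  apply/funext => k; rewrite {1}[k]row_sum_delta -[LHS]/(g _) linear_sum.
  by apply: eq_bigr => i _; rewrite linearZ.
apply: (continuous_big (op := +%R)) => [|i _ k].
  exact: (@add_continuous R^o).
apply: (@continuousM R _ (fun p : 'rV[R]_N => p 0 i) (fun=> _)).
  exact: coord_continuous.
exact: cst_continuous.
Qed.

(** First-order optimality: along a feasible segment a quadratic that is minimal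
    at its initial point has a nonnegative initial slope [2 a]. *)
Lemma first_order_ge0 (a b : R) :
  (forall t, 0 < t <= 1 -> 0 <= t * (2 * a) + t ^+ 2 * b) -> 0 <= a.
Proof.
move=> ab; rewrite leNgt; apply/negP => a0.
have [b0|b0] := lerP b (- a).
  by have := ab 1; rewrite ltr01 lexx expr1n => /(_ isT); nra.
have bp : 0 < b by nra.
have /ab : 0 < - a / b <= 1.
  by rewrite divr_gt0 ?oppr_gt0 //= ler_pdivrMr // mul1r ltW.
have -> : - a / b * (2 * a) + (- a / b) ^+ 2 * b = - (a ^+ 2 / b).
  by field; rewrite gt_eqF.
by rewrite oppr_ge0 leNgt divr_gt0 // exprn_even_gt0 //= lt_eqF.
Qed.

(** The point of the image cone [phi K] nearest to [C] exists because
    the coercivity hypothesis, that is pairing with [S], bounds the sublevel sets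
    of the distance on [K].  The residual [phi w - C] at that point is
    nonnegative on [phi K] and orthogonal to [phi w], so the bidual hypothesis
    tested on it bounds its own square norm by zero.  Presenting the closed cone
    [K] by linear inequalities makes both closedness and the cone axioms
    automatic. *)
Lemma conic_farkas N m k (I : Type) (psi_ : I -> 'rV[R]_N -> R)
    (phi_ : 'rV[R]_N -> 'M[R]_(m, k)) (S C : 'M[R]_(m, k)) (delta : R) :
  let K := [set w | forall i, 0 <= psi_ i w] in
  (forall i, scalar (psi_ i)) -> linear phi_ -> 0 < delta ->
  (forall w, K w -> forall j, delta * `|w 0 j| <= mxdot S (phi_ w)) ->
  (forall M, (forall w, K w -> 0 <= mxdot (phi_ w) M) -> 0 <= mxdot C M) ->
  exists2 w, K w & phi_ w = C.
Proof.
move=> K psiL phiL d0 coer bidual.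
pose psi i : {scalar 'rV[R]_N} :=
  HB.pack (psi_ i) (GRing.isLinear.Build _ _ _ _ _ (psiL i)).
pose phi : {linear 'rV[R]_N -> 'M[R]_(m, k)} :=
  HB.pack phi_ (GRing.isLinear.Build _ _ _ _ _ phiL).
have {}coer w : K w -> forall j, delta * `|w 0 j| <= mxdot S (phi w).
  exact: coer.
rewrite -[phi_]/(phi : _ -> _) in bidual *.
pose res w := phi w - C.
pose f w := mxdot (res w) (res w).
have psi0 i : psi_ i 0 = 0 := linear0 (psi i).
have K0 : K 0 by move=> i; rewrite psi0.
have KD w z : K w -> K z -> K (w + z).
  by move=> Kw Kz i; rewrite [psi_ i _](linearD (psi i)); exact: addr_ge0 (Kw i) (Kz i).
have KZ a w : 0 <= a -> K w -> K (a *: w).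
  by move=> a0 Kw i; rewrite -[_ *: _]addr0 psiL psi0 addr0; exact: mulr_ge0 a0 (Kw i).
(* On a sublevel set of [f], [<S, res w>] is bounded by the arithmetic-geometric
   mean inequality. *)
pose rho := f 0 + mxdot S S + mxdot S C.
pose A := [set w | K w /\ mxdot S (phi w) <= rho].
have sublevel w : f w <= f 0 -> mxdot S (phi w) <= rho.
  have -> : phi w = res w + C by rewrite subrK.
  rewrite mxdotDr lerD2r {1}/f; move: (res w) (f 0) => r f0 fr.
  have := mxdot_ge0 (r - S); rewrite mxdotBl !mxdotBr (mxdotC r S).
  by have := mxdot_ge0 r; have := mxdot_ge0 S; lra.
have phi_cont : continuous (fun w => mxdot S (phi w)).
  apply: scalar_rV_continuous => a u v.
  by rewrite linearP mxdotDr mxdotZr.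
have f_cont : continuous f.
  have -> : f = fun w => \sum_i \sum_j res w i j * res w i j.
    by apply/funext => w; rewrite /f mxdotE.
  apply: (continuous_big (op := +%R)) => [|i _]; first exact: (@add_continuous R^o).
  apply: (continuous_big (op := +%R)) => [|j _]; first exact: (@add_continuous R^o).
  have res_cont : continuous (fun w => res w i j : R).
    have cphi : continuous (fun w => phi w i j : R).
      by apply: scalar_rV_continuous => a u v; rewrite linearP !mxE.
    have -> : (fun w => res w i j) = fun w => phi w i j + - C i j.
      by apply/funext => w; rewrite !mxE.
    move=> w; apply: (@continuousD R R^o _ (fun w => phi w i j) (fun=> - C i j)).
      exact: cphi.
    exact: cst_continuous.
  by move=> w; apply: (@continuousM R); exact: res_cont.
have A0 : A 0 by split=> //; exact: sublevel.
have A_compact : compact A.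
  have A_closed : closed A.
    have -> : A = \bigcap_(i in setT) [set w | 0 <= psi i w]
                  `&` [set w | mxdot S (phi w) <= rho].
      apply/seteqP; split=> w; first by case=> Kw wr; split=> // i _; exact: Kw.
      by case=> Kw wr; split=> // i; exact: Kw.
    apply: closedI.
      apply: closed_bigI => i _.
      apply: (preimage_closed _ (@closed_ge R 0)) => w _.
      exact: (scalar_rV_continuous (linearP (psi i))).
    by apply: (preimage_closed _ (@closed_le R rho)) => w _; exact: phi_cont.
  apply: (subclosed_compact A_closed
    (@rV_compact _ _ (fun=> `[- (rho / delta), rho / delta]%classic) _)).
    by move=> _; exact: segment_compact.
  move=> w [Kw wr] j /=; rewrite in_itv /= -ler_norml ler_pdivlMr // mulrC.
  exact: le_trans (coer w Kw j) wr.
have [w /set_mem [Kw _] wmin] :=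
  compact_EVT_min (ex_intro _ 0 A0) A_compact (continuous_subspaceT f_cont).
have f_min z : K z -> f w <= f z.
  move=> Kz; have [fz|fz] := lerP (f z) (f 0).
    by apply: wmin; apply/mem_set; split=> //; exact: sublevel.
  by apply: le_trans (ltW fz); apply: wmin; exact/mem_set.
exists w => //; apply/eqP; rewrite -subr_eq0; apply/eqP/mxdot_eq0.
have expand a z : f (w + a *: z) =
    f w + a * (2 * mxdot (phi z) (res w)) + a ^+ 2 * mxdot (phi z) (phi z).
  have -> : f (w + a *: z) = mxdot (res w + a *: phi z) (res w + a *: phi z).
    by rewrite /f /res linearD linearZ addrAC.
  rewrite /f; move: (res w) (phi z) => r p.
  by rewrite mxdotDl !mxdotDr !mxdotZl !mxdotZr (mxdotC r p); ring.
have res_dual z : K z -> 0 <= mxdot (phi z) (res w).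
  move=> Kz; apply: first_order_ge0 => t /andP[/ltW t0 _].
  have /f_min := KD _ _ Kw (KZ _ _ t0 Kz).
  by rewrite expand -addrA lerDl; exact.
have res_w : mxdot (phi w) (res w) <= 0.
  rewrite -oppr_ge0; apply: first_order_ge0 => t /andP[t0 t1].
  have /f_min : K (w + (- t) *: w).
    by rewrite -{1}[w]scale1r -scalerDl; apply: KZ => //; rewrite subr_ge0.
  by rewrite expand -addrA lerDl sqrrN mulNr mulrN -mulrN; apply.
have := bidual _ res_dual.
rewrite -/(res w) {2}/res.
by rewrite mxdotBl; move: res_w; lra.
Qed.

End ConicFarkas.

(** * Positive semidefinite matrices *)

Section PositiveSemidefinite.
Variable R : realType.

Lemma mxdot_col k (a b : 'cV[R]_k) : mxdot a b = (a^T *m b) 0 0.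
Proof. by rewrite /mxdot trace_mx11. Qed.

Lemma psdP k (H : 'M[R]_k) :
  psd H <-> (forall z : 'cV[R]_k, 0 <= mxdot z (H *m z)).
Proof. by split=> h z; have := h z; rewrite mxdot_col mulmxA. Qed.

Lemma mxdot_delta m k (A : 'M[R]_(m, k)) i j : mxdot (delta_mx i j) A = A i j.
Proof.
rewrite mxdotE (bigD1 i) //= (bigD1 j) //= mxE !eqxx mul1r.
rewrite !big1 ?addr0 // => [i' ni|j' nj].
  by rewrite big1 // => j' _; rewrite mxE (negPf ni) mul0r.
by rewrite mxE (negPf nj) andbF mul0r.
Qed.

Section Form.
Variables (k : nat) (H : 'M[R]_k).
Hypotheses (H_sym : symmetric_mx H) (H_psd : psd H).

Lemma mxdot_sym (a b : 'cV[R]_k) : mxdot (H *m a) b = mxdot a (H *m b).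
Proof. by rewrite /mxdot trmx_mul H_sym mulmxA. Qed.

Lemma psd_cauchy_schwarz (a b : 'cV[R]_k) :
  mxdot a (H *m b) ^+ 2 <= mxdot a (H *m a) * mxdot b (H *m b).
Proof.
set p := mxdot a (H *m a); set r := mxdot a (H *m b); set q := mxdot b (H *m b).
have bHa : mxdot b (H *m a) = r by rewrite -mxdot_sym mxdotC.
have E s : 0 <= p + 2 * s * r + s ^+ 2 * q.
  have /psdP/(_ (a + s *: b)) := H_psd.
  rewrite mulmxDr -scalemxAr mxdotDl !mxdotDr !mxdotZl !mxdotZr bHa -/p -/r -/q.
  by move=> h; lra.
have : 0 <= q by exact: (psdP H).1.
rewrite le_eqVlt => /predU1P[q0|q0].
  have [->|r0] := eqVneq r 0; first by rewrite -q0 expr0n mulr0.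
  (* The value at this [s] would be [-1]. *)
  have := E (- (p + 1) / (2 * r)); rewrite -q0 mulr0 addr0.
  have -> : p + 2 * (- (p + 1) / (2 * r)) * r = -1 by field.
  by rewrite ler0N1.
(* The minimiser over [s]. *)
rewrite -ler_pdivrMr //; have := E (- r / q).
have -> : p + 2 * (- r / q) * r + (- r / q) ^+ 2 * q = p - r ^+ 2 / q.
  by field; rewrite gt_eqF.
by rewrite subr_ge0.
Qed.

Lemma psd_ker (v : 'cV[R]_k) : mxdot v (H *m v) = 0 -> H *m v = 0.
Proof.
move=> v0; apply: mxdot_eq0; have := psd_cauchy_schwarz (H *m v) v.
by rewrite v0 mulr0; nra.
Qed.

Lemma mxdot_delta_form (i j : 'I_k) :
  mxdot (delta_mx i 0 : 'cV_k) (H *m delta_mx j 0) = H i j.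
Proof. by rewrite mxdot_delta -colE mxE. Qed.

Lemma psd_diag_ge0 i : 0 <= H i i.
Proof. by rewrite -mxdot_delta_form; exact: (psdP H).1. Qed.

Lemma psd_entry_sqr i j : H i j ^+ 2 <= H i i * H j j.
Proof. by rewrite -!mxdot_delta_form; exact: psd_cauchy_schwarz. Qed.

Lemma psd_diag_le_trace i : H i i <= \tr H.
Proof.
rewrite /mxtrace (bigD1 i) //= lerDl; apply: sumr_ge0 => j _.
exact: psd_diag_ge0.
Qed.

Lemma psd_entry_le_trace i j : `|H i j| <= \tr H.
Proof.
have := psd_diag_le_trace i; have := psd_diag_le_trace j.
have := psd_diag_ge0 i; have := psd_diag_ge0 j; have := psd_entry_sqr i j.
move=> ij j0 i0 jt it; rewrite -ler_sqr ?nnegrE ?(le_trans i0 it) //.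
by rewrite real_normK ?num_real //; nra.
Qed.

End Form.

(** Each nonzero diagonal entry [H i i] lets one split off from [H] the psd
    rank-one matrix [w w^T / H i i], with [w] the [i]-th column.  The remainder is
    psd by Cauchy-Schwarz, its [i]-th diagonal entry is zero, and diagonal entries
    that were zero remain so; a psd matrix with zero diagonal is zero. *)
Lemma psd_mxdot_ge0 k (H Y : 'M[R]_k) :
  symmetric_mx H -> psd H -> psd Y -> 0 <= mxdot H Y.
Proof.
move=> H_sym H_psd Y_psd.
have [m] := ubnP #|[set i | H i i != 0]%SET|.
elim: m H H_sym H_psd => // m IH H H_sym H_psd Hm.
have [i Hi|H0] := pickP (fun i => H i i != 0); last first.
  suff -> : H = 0 by rewrite mxdotE !big1 // => i _; rewrite big1 // => j _;
    rewrite mxE mul0r.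
  apply/matrixP => i j; have := psd_entry_sqr H_sym H_psd i j.
  have /negbFE/eqP -> := H0 i; rewrite mul0r mxE => ij.
  by apply/eqP; rewrite -sqrf_eq0 eq_le ij sqr_ge0.
have Hi0 : 0 < H i i by rewrite lt_def Hi psd_diag_ge0.
pose w := H *m delta_mx i 0 : 'cV_k.
pose H' := H - (H i i)^-1 *: (w *m w^T).
have wE j : w j 0 = H j i by rewrite /w -colE mxE.
have H'E j : H' j j = H j j - (H i i)^-1 * H j i ^+ 2.
  by rewrite /H' 4!mxE big_ord1 [w^T _ _]mxE !wE.
have -> : H = H' + (H i i)^-1 *: (w *m w^T) by rewrite subrK.
rewrite mxdotDl mxdotZl addr_ge0 //; last first.
  rewrite mulr_ge0 ?invr_ge0 ?(ltW Hi0) // mxdotC mxdot_rank1; exact: Y_psd.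
apply: IH.
- by rewrite /symmetric_mx linearB linearZ /= trmx_mul trmxK H_sym.
- apply/psdP => z; rewrite mulmxBl mxdotBr -scalemxAl mxdotZr subr_ge0.
  rewrite mulrC ler_pdivrMr // -mulmxA.
  have -> : mxdot z (w *m (w^T *m z)) = mxdot z w ^+ 2.
    rewrite [w^T *m z]mx11_scalar mul_mx_scalar mxdotZr -mxdot_col.
    by rewrite (mxdotC w z) expr2.
  by apply: le_trans (psd_cauchy_schwarz H_sym H_psd _ _) _; rewrite mxdot_delta_form.
- rewrite ltnS in Hm; apply: leq_trans Hm; apply: proper_card; apply/properP; split.
    apply/fintype.subsetP => j; rewrite !inE; apply: contra => /eqP Hj.
    have := psd_entry_sqr H_sym H_psd j i; rewrite Hj mul0r => ji.
    have -> : H' j j = 0; last by [].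
    rewrite H'E Hj sub0r; have -> : H j i ^+ 2 = 0.
      by apply/eqP; rewrite eq_le ji sqr_ge0.
    by rewrite mulr0 oppr0.
  exists i; rewrite !inE // H'E negbK; apply/eqP.
  by field.
Qed.
End PositiveSemidefinite.

(** * A Farkas lemma for semidefinite cones *)

Section SemidefiniteFarkas.
Variable R : realType.

Lemma symmetric_mxE k (A : 'M[R]_k) :
  symmetric_mx A -> forall i j, A i j = A j i.
Proof. by move=> A_sym i j; rewrite -{1}A_sym mxE. Qed.

Lemma mxdot_trmx m k (A B : 'M[R]_(m, k)) : mxdot A^T B^T = mxdot A B.
Proof. by rewrite /mxdot trmxK mxtrace_mulC -mxtrace_tr trmx_mul trmxK. Qed.

(** The cone of certificates [G^T L G + H] is the image of a closed cone of pairs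
    [(L, H)], and the strictly feasible [S] makes it coercive: pairing with [S]
    dominates the entries of [L], by the gap in [G S G^T], and the trace of [H],
    hence its entries. *)
Lemma sdp_farkas p q (G : 'M[R]_(p, q)) (S C : 'M[R]_q) (delta : R) :
  0 < delta ->
  (forall i j, delta <= (G *m S *m G^T) i j) ->
  (forall H : 'M[R]_q, symmetric_mx H -> psd H -> delta * \tr H <= mxdot S H) ->
  symmetric_mx C ->
  (forall M : 'M[R]_q, symmetric_mx M -> psd M ->
     (forall i j, 0 <= (G *m M *m G^T) i j) -> 0 <= mxdot C M) ->
  exists (L : 'M[R]_p) (H : 'M[R]_q),
    [/\ symmetric_mx L, (forall i j, 0 <= L i j), symmetric_mx H, psd H &
        C = G^T *m L *m G + H].
Proof.
move=> d0 S_rlt S_psd C_sym C_dual.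
pose lam (w : 'rV[R]_(p * p + q * q)) : 'M[R]_p := vec_mx (lsubmx w).
pose hh (w : 'rV[R]_(p * p + q * q)) : 'M[R]_q := vec_mx (rsubmx w).
pose phi w : 'M[R]_q := G^T *m (lam w + (lam w)^T) *m G + hh w.
(* A multiplier pair is coded as one row vector.  The matrix [lam w] is left
   asymmetric and symmetrised in [phi]; symmetry of [hh w] has to be imposed, as
   its antisymmetric part would escape the trace bound. *)
pose psi (i : ('I_p * 'I_p) + (('I_q * 'I_q) + 'cV[R]_q)) w : R :=
  match i with
  | inl ij => lam w ij.1 ij.2
  | inr (inl ij) => hh w ij.1 ij.2 - hh w ij.2 ij.1
  | inr (inr z) => mxdot (hh w) (z *m z^T)
  end.
have lamL : linear lam by move=> a u v; rewrite /lam !linearP.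
have hhL : linear hh by move=> a u v; rewrite /hh !linearP.
have psiL i : scalar (psi i).
  case: i => [ij|[ij|z]] a u v /=.
  - by rewrite lamL !mxE.
  - by rewrite hhL ![(_ *: _ + _ : 'M[R]_q) _ _]mxE ![(_ *: _ : 'M[R]_q) _ _]mxE; ring.
  - by rewrite hhL mxdotDl mxdotZl.
have phiL : linear phi.
  move=> a u v; rewrite /phi lamL hhL.
  rewrite linearP /= addrACA -scalerDr mulmxDr mulmxDl -scalemxAr -scalemxAl.
  by rewrite scalerDr addrACA.
pose K := [set w | forall i, 0 <= psi i w].
have KP w : K w <->
  [/\ forall i j, 0 <= lam w i j, symmetric_mx (hh w) & psd (hh w)].
  split=> [Kw|[lw sw pw] [ij|[ij|z]]] /=.
  - split=> [i j||z]; first exact: (Kw (inl (i, j))).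
      apply/matrixP => i j; rewrite mxE; apply/eqP; rewrite eq_le -[X in X && _]subr_ge0.
      rewrite -[X in _ && X]subr_ge0.
      by rewrite (Kw (inr (inl (i, j)))) (Kw (inr (inl (j, i)))).
    by rewrite -mxdot_rank1; exact: (Kw (inr (inr z))).
  - exact: lw.
  - by rewrite (symmetric_mxE sw) subrr.
  - by rewrite mxdot_rank1; exact: pw.
have phiE w (M : 'M[R]_q) : mxdot (phi w) M =
    mxdot (lam w) (G *m M *m G^T + (G *m M *m G^T)^T) + mxdot (hh w) M.
  by rewrite mxdotDl mxdot_congr mxdotDl mxdotDr -(mxdot_trmx (lam w)^T) trmxK.
have coer w : K w -> forall j, delta * `|w 0 j| <= mxdot S (phi w).
  move=> /KP[lam0 h_sym h_psd] j; rewrite mxdotC phiE.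
  have lamS : delta * \sum_i \sum_j lam w i j
      <= mxdot (lam w) (G *m S *m G^T + (G *m S *m G^T)^T).
    rewrite mxdotE mulr_sumr; apply: ler_sum => i _.
    rewrite mulr_sumr; apply: ler_sum => j' _; rewrite mulrC ler_wpM2l //.
    rewrite mxE [X in _ + X]mxE.
    by have := S_rlt i j'; have := S_rlt j' i; lra.
  have hS := S_psd _ h_sym h_psd; rewrite mxdotC in hS.
  apply: le_trans (lerD lamS hS); rewrite -mulrDr ler_wpM2l ?(ltW d0) //.
  have tr0 : 0 <= \tr (hh w) by apply: sumr_ge0 => i _; exact: psd_diag_ge0.
  have lamT0 : 0 <= \sum_i \sum_j lam w i j.
    by do 2!apply: sumr_ge0 => ? _.
  have [j1 ->|j2 ->] := split_ordP j.
    case/mxvec_indexP: j1 => i' j'.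
    have -> : w 0 (lshift _ (mxvec_index i' j')) = lam w i' j' by rewrite !mxE.
    rewrite ger0_norm // (bigD1 i') //= (bigD1 j') //= -!addrA lerDl.
    do !rewrite addr_ge0 //; apply: sumr_ge0 => // ? _.
    by apply: sumr_ge0 => ? _.
  case/mxvec_indexP: j2 => i' j'.
  have -> : w 0 (rshift _ (mxvec_index i' j')) = hh w i' j' by rewrite !mxE.
  by rewrite (le_trans (psd_entry_le_trace h_sym h_psd i' j')) // lerDr.
have bidual D : (forall w, K w -> 0 <= mxdot (phi w) D) -> 0 <= mxdot C D.
  (* Both [C] and the certificates are symmetric, so they only see the
     symmetric part of a test matrix. *)
  move=> D_dual; pose M := D + D^T.
  have enc (l : 'M[R]_p) (h : 'M[R]_q) : exists w, lam w = l /\ hh w = h.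
    exists (row_mx (mxvec l) (mxvec h)).
    by rewrite /lam /hh row_mxKl row_mxKr !mxvecK.
  have : 0 <= mxdot C M.
    apply: C_dual.
    - by rewrite /symmetric_mx linearD /= trmxK addrC.
    - move=> z; rewrite -mxdot_rank1 mxdotDl.
      have -> : mxdot D^T (z *m z^T) = mxdot D (z *m z^T).
        by rewrite -mxdot_trmx trmxK trmx_mul trmxK.
      have [w [lw hw]] := enc 0 (z *m z^T).
      suff : 0 <= mxdot (phi w) D.
        by rewrite phiE lw hw mxdotC mxdotE big1 ?add0r ?(mxdotC D) => [?|i _];
          [exact: addr_ge0|rewrite big1 // => j _; rewrite [X in _ * X]mxE mulr0].
      apply/D_dual/KP; rewrite lw hw; split.
      + by move=> i j; rewrite mxE.
      + by rewrite /symmetric_mx trmx_mul trmxK.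
      + move=> y; rewrite mulmxA -mulmxA -[y^T *m z]trmxK trmx_mul trmxK -mxdot_col.
        exact: mxdot_ge0.
    - move=> i j; have [w [lw hw]] := enc (delta_mx i j) 0.
      have : 0 <= mxdot (phi w) D.
        apply/D_dual/KP; rewrite lw hw; split.
        + by move=> i' j'; rewrite mxE ler0n.
        + by rewrite /symmetric_mx trmx0.
        + by move=> z; rewrite mulmx0 mul0mx mxE.
      rewrite phiE lw hw mxdot_delta.
      rewrite [mxdot 0 _]mxdotE [X in _ + X]big1 ?addr0 => [|i' _]; last first.
        by rewrite big1 // => j' _; rewrite mxE mul0r.
      rewrite !trmx_mul trmxK mulmxA /M mulmxDr mulmxDl; exact.
  rewrite mxdotDr -[X in _ + X]mxdot_trmx trmxK C_sym; lra.
have [w /KP[lam0 h_sym h_psd] phiw] := conic_farkas psiL phiL d0 coer bidual.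
exists (lam w + (lam w)^T), (hh w); split=> //.
- by rewrite /symmetric_mx linearD /= trmxK addrC.
- by move=> i j; rewrite mxE [X in _ + X]mxE addr_ge0.
Qed.
End SemidefiniteFarkas.

(** * Lifted matrices *)

Section Lifting.
Variables (R : realType) (n : nat).
Implicit Types (x c h y : 'cV[R]_n) (X Q H W Y Z : 'M[R]_n).

(** The homogenisation of [(x, X)]; the corner [k] is [1] on the relaxation. *)
Definition lift_mx (k : R) x X : 'M[R]_(1 + n) := block_mx k%:M x^T x X.

(** The rows are the forms [x_i] and [1 - x_i] on vectors [(1, x)]. *)
Definition facet_mx : 'M[R]_(n + n, 1 + n) :=
  block_mx 0 1%:M (const_mx 1) (- 1%:M).

Lemma lift_mx_eta (M : 'M[R]_(1 + n)) : symmetric_mx M ->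
  exists k x X, M = lift_mx k x X /\ symmetric_mx X.
Proof.
rewrite -(submxK M) /symmetric_mx tr_block_mx => /eq_block_mx[_ _ urE drE].
exists (ulsubmx M 0 0), (dlsubmx M), (drsubmx M); split=> //.
by rewrite /lift_mx -mx11_scalar -[X in block_mx _ X _ _]trmxK urE.
Qed.

Lemma lift_mx_sym k x X : symmetric_mx X -> symmetric_mx (lift_mx k x X).
Proof. by move=> X_sym; rewrite /symmetric_mx tr_block_mx trmxK tr_scalar_mx X_sym. Qed.

Lemma lift_mx_inj k x X k' x' X' :
  lift_mx k x X = lift_mx k' x' X' -> x = x' /\ X = X'.
Proof. by case/eq_block_mx. Qed.

Lemma lift_mxZ a k x X : a *: lift_mx k x X = lift_mx (a * k) (a *: x) (a *: X).
Proof. by rewrite /lift_mx scale_block_mx scale_scalar_mx linearZ. Qed.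

Lemma mxdot_lift k x X k' x' X' :
  mxdot (lift_mx k x X) (lift_mx k' x' X') = k * k' + 2 * mxdot x x' + mxdot X X'.
Proof.
rewrite /mxdot tr_block_mx mulmx_block mxtrace_block !mxtraceD tr_scalar_mx trmxK.
rewrite -scalar_mxM mxtrace_scalar (mxtrace_mulC x).
have -> : \tr (x'^T *m x) = \tr (x^T *m x') by rewrite -[LHS]mxtrace_tr trmx_mul trmxK.
by rewrite mulr1n; ring.
Qed.

Lemma lift_rank1 x : lift_mx 1 x (x *m x^T) = col_mx 1%:M x *m (col_mx 1%:M x)^T.
Proof.
by rewrite tr_col_mx mul_col_row tr_scalar_mx mulmx1 mul1mx mulmx1.
Qed.

Lemma lift_form k x X s y :
  mxdot (col_mx s%:M y) (lift_mx k x X *m col_mx s%:M y)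
  = k * s ^+ 2 + 2 * s * mxdot x y + mxdot y (X *m y).
Proof.
rewrite mul_block_col /mxdot tr_col_mx mul_row_col mxtraceD !mulmxDr !mxtraceD.
rewrite tr_scalar_mx mul_scalar_mx -scalar_mxM scale_scalar_mx mxtrace_scalar.
rewrite mul_scalar_mx mxtraceZ mul_mx_scalar -scalemxAr mxtraceZ.
have -> : \tr (y^T *m x) = \tr (x^T *m y) by rewrite -[LHS]mxtrace_tr trmx_mul trmxK.
by rewrite mulr1n; ring.
Qed.

Lemma psd_liftP k x X :
  psd (lift_mx k x X) <->
  (forall s y, 0 <= k * s ^+ 2 + 2 * s * mxdot x y + mxdot y (X *m y)).
Proof.
split=> [/psdP M_psd s y|M_psd]; first by rewrite -lift_form.
apply/psdP => z; rewrite -[z]vsubmxK [usubmx z]mx11_scalar lift_form.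
exact: M_psd.
Qed.

Lemma facet_congr k x X :
  facet_mx *m lift_mx k x X *m facet_mx^T =
  block_mx X (\matrix_(i, j) (x i 0 - X i j))
    (\matrix_(i, j) (x j 0 - X i j))
    (\matrix_(i, j) (k - x i 0 - x j 0 + X i j)).
Proof.
rewrite tr_block_mx !mulmx_block !mul0mx !mul1mx !trmx0 !linearN /= !trmx1 !add0r.
rewrite !mulmx0 !mulmx1 !add0r !mulNmx !mul1mx mul_mx_scalar scalemx_const mulr1.
by congr block_mx; apply/matrixP => i j; rewrite !mxE ?big_ord1 ?mxE ?eqxx ?mulr1n; ring.
Qed.

(** Expanding a dual certificate over the forms [x_i] and [1 - x_i] gives the
    formulas of the algorithm.  The upper right block is [Y^T] because [Y i j] is
    the multiplier of [(1 - x_i) x_j]. *)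
Lemma dual_lift beta h W Y Z H : symmetric_mx W ->
  facet_mx^T *m block_mx Z Y^T Y W *m facet_mx + lift_mx beta h H =
  lift_mx (mxdot (ones R n) (W *m ones R n) + beta)
    (- (W *m ones R n) + Y^T *m ones R n + h) (algorithm3_Q W Y Z H).
Proof.
move=> W_sym.
rewrite tr_block_mx !mulmx_block !trmx0 !linearN /= !trmx1 !mul0mx !mul1mx !add0r.
rewrite !mulmx0 !mulmx1 !add0r !mulNmx !mul1mx.
rewrite add_block_mx.
rewrite /lift_mx; congr block_mx.
- by rewrite raddfD /= mxdot_col mulmxA -mx11_scalar.
- rewrite !linearD linearN /= !trmx_mul W_sym trmxK; congr (_ + _).
  by rewrite addrC.
- by rewrite mulmxBl (addrC (- _)).
- rewrite /algorithm3_Q opprB.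
  by apply/matrixP => i j; rewrite !mxE; ring.
Qed.

End Lifting.

(** * The relaxation as a semidefinite program *)

Section Relaxation.
Variables (R : realType) (n : nat).
Implicit Types (x c h y : 'cV[R]_n) (X Q H W Y Z : 'M[R]_n).

Lemma mxdot_sqr (x y : 'cV[R]_n) :
  mxdot y ((x *m x^T) *m y) = mxdot x y ^+ 2.
Proof.
rewrite -mulmxA [x^T *m y]mx11_scalar -mxdot_col mul_mx_scalar mxdotZr.
by rewrite mxdotC expr2.
Qed.

(** Schur complement: both quadratic forms agree after completing the square in
    the first coordinate. *)
Lemma psd_lift1 x X : psd (X - x *m x^T) <-> psd (lift_mx 1 x X).
Proof.
split=> [/psdP p|/psd_liftP p].
  apply/psd_liftP => s y; have := p y; rewrite mulmxBl mxdotBr mxdot_sqr.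
  by have := sqr_ge0 (s + mxdot x y); rewrite sqrrD; lra.
apply/psdP => y; have := p (- mxdot x y) y.
by rewrite mulmxBl mxdotBr mxdot_sqr; lra.
Qed.

Definition rlt (M : 'M[R]_(1 + n)) : Prop :=
  forall i j, 0 <= (facet_mx R n *m M *m (facet_mx R n)^T) i j.

Lemma rlt_liftP k x X : symmetric_mx X ->
  rlt (lift_mx k x X) <->
  (forall i j, [/\ 0 <= X i j, X i j <= x i 0 & 0 <= k - x i 0 - x j 0 + X i j]).
Proof.
move=> X_sym; rewrite /rlt facet_congr; split=> [M0 i j|X0 i j].
  have := M0 (lshift n i) (lshift n j); have := M0 (lshift n i) (rshift n j).
  have := M0 (rshift n i) (rshift n j).
  by rewrite block_mxEul block_mxEur block_mxEdr !mxE subr_ge0.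
have [i' ->|i' ->] := split_ordP i; have [j' ->|j' ->] := split_ordP j;
  rewrite ?(block_mxEul, block_mxEur, block_mxEdl, block_mxEdr) ?mxE.
- by have [] := X0 i' j'.
- by have [] := X0 i' j'; rewrite subr_ge0.
- by rewrite (symmetric_mxE X_sym) subr_ge0; have [] := X0 j' i'.
- by have [] := X0 i' j'.
Qed.

(** The bounds on [x] come from the diagonal RLT inequalities: [0 <= X i i <= x i]
    and [2 x i - 1 <= X i i] give [0 <= x i <= 1]. *)
Lemma F_RSP x X : F_RS (x, X) <->
  [/\ symmetric_mx X, psd (lift_mx 1 x X) & rlt (lift_mx 1 x X)].
Proof.
split=> [[[/= _ X_sym X_rlt] /psd_lift1 X_psd]|[X_sym /psd_lift1 X_psd X_rlt]].
  split=> //; apply/rlt_liftP => //.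
  have le_rlt (i j : 'I_n) : (i <= j)%N ->
    [/\ 0 <= X i j, X i j <= x i 0, X i j <= x j 0 &
        0 <= 1 - x i 0 - x j 0 + X i j].
    by move=> /X_rlt; rewrite ge_max le_min -!andbA => /and4P[a b c d]; split=> //; lra.
  move=> i j; have [/le_rlt[] //|/ltnW/le_rlt[a b c d]] := leqP i j.
  by rewrite (symmetric_mxE X_sym); split=> //; lra.
have {}X_rlt := (rlt_liftP _ _ X_sym).1 X_rlt.
split=> //=; split=> //= [i|i j _].
  by have [a b c] := X_rlt i i; apply/andP; split; lra.
have [a b c] := X_rlt i j; have [_ d _] := X_rlt j i.
rewrite (symmetric_mxE X_sym) in d.
by rewrite ge_max le_min -!andbA; apply/and4P; split=> //; lra.
Qed.

Lemma lifted_objE Q c x X k :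
  2 * lifted_obj Q c (x, X) + k = mxdot (lift_mx k c Q) (lift_mx 1 x X).
Proof.
by rewrite mxdot_lift /lifted_obj /= -mxdot_col; field.
Qed.

Lemma lifted_obj_rank1 Q c x :
  lifted_obj Q c (x, x *m x^T) = box_qp_obj Q c x.
Proof. by rewrite /lifted_obj /box_qp_obj /= mxdot_rank1. Qed.

Lemma F_RS_rank1 x : box x -> F_RS (x, x *m x^T).
Proof.
move=> x_box; have xx_sym : symmetric_mx (x *m x^T).
  by rewrite /symmetric_mx trmx_mul trmxK.
apply/F_RSP; split=> //.
  apply/psd_lift1 => z; by rewrite subrr mulmx0 mul0mx mxE.
apply/rlt_liftP => // i j; rewrite mxE big_ord1 [x^T _ _]mxE.
by have /andP[a b] := x_box i; have /andP[c d] := x_box j; split; nra.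
Qed.

(** For a positive corner this is a rescaling.  A zero corner forces [x = 0] since
    [M] is psd, and then [X = 0] by the bounds [0 <= X i j <= x i]. *)
Lemma lifted_obj_ge0_on_cone ell Q c :
  (forall p, F_RS p -> ell <= lifted_obj Q c p) ->
  forall M : 'M[R]_(1 + n), symmetric_mx M -> psd M -> rlt M ->
  0 <= mxdot (lift_mx (- 2 * ell) c Q) M.
Proof.
move=> ell_le M M_sym M_psd M_rlt.
have [k [x [X [ME X_sym]]]] := lift_mx_eta M_sym.
have k0 : 0 <= k.
  have := psd_diag_ge0 M_psd (lshift n 0).
  by rewrite ME block_mxEul mxE eqxx mulr1n.
move: k0; rewrite le_eqVlt => /predU1P[k0|k0].
  have x0 i : x i 0 = 0.
    have := psd_entry_sqr M_sym M_psd (rshift 1 i) (lshift n 0).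
    rewrite ME block_mxEdl block_mxEul -k0 [0%:M _ _]mxE mul0rn mulr0 => x2.
    by apply/eqP; rewrite -sqrf_eq0 eq_le x2 sqr_ge0.
  rewrite ME -k0 mxdot_lift mulr0 add0r.
  rewrite [mxdot c x]mxdotE big1 ?mulr0 ?add0r => [|i _]; last first.
    by rewrite big_ord1 x0 mulr0.
  rewrite mxdotE; apply: sumr_ge0 => i _; apply: sumr_ge0 => j _.
  rewrite ME in M_rlt; have [] := (rlt_liftP _ _ X_sym).1 M_rlt i j.
  by rewrite x0 => a b _; rewrite (_ : X i j = 0) ?mulr0 //; lra.
pose y := k^-1 *: x; pose Y := k^-1 *: X.
have YE : lift_mx 1 y Y = k^-1 *: M.
  by rewrite ME lift_mxZ mulVf // gt_eqF.
have -> : M = k *: lift_mx 1 y Y by rewrite YE scalerA mulfV ?scale1r // gt_eqF.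
rewrite mxdotZr mulr_ge0 ?(ltW k0) // -lifted_objE.
suff /ell_le : F_RS (y, Y) by lra.
apply/F_RSP; rewrite YE; split.
- by rewrite /symmetric_mx linearZ /= X_sym.
- apply/psdP => z; rewrite -scalemxAl mxdotZr mulr_ge0 ?invr_ge0 ?(ltW k0) //.
  exact: (psdP M).1.
- move=> i j; rewrite -scalemxAr -scalemxAl mxE mulr_ge0 ?invr_ge0 ?(ltW k0) //.
Qed.

(** The point [x = e / 2], [X = e e^T / 4 + I / 8]: every RLT inequality has slack
    at least [1/8], and [X - x x^T = I / 8] is positive definite. *)
Definition slater_mx : 'M[R]_(1 + n) :=
  lift_mx 1 (const_mx 2^-1) (const_mx 4^-1 + (8^-1)%:M).

Definition slater_gap : R := (4 * (n%:R ^+ 2 + 2))^-1.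

Lemma slater_gap_gt0 : 0 < slater_gap.
Proof. by rewrite invr_gt0 mulr_gt0 // ltr_wpDl // sqr_ge0. Qed.

Lemma slater_rlt i j :
  slater_gap <= (facet_mx R n *m slater_mx *m (facet_mx R n)^T) i j.
Proof.
have gap : slater_gap <= 8^-1.
  rewrite lef_pV2 ?posrE // ?mulr_gt0 ?ltr_wpDl ?sqr_ge0 //.
  by have := sqr_ge0 (n%:R : R); lra.
rewrite facet_congr.
have [i' ->|i' ->] := split_ordP i; have [j' ->|j' ->] := split_ordP j;
  rewrite ?(block_mxEul, block_mxEur, block_mxEdl, block_mxEdr) ?mxE;
  by case: (i' == j'); rewrite ?mulr1n ?mulr0n; lra.
Qed.

(** Pairing with [slater_mx] is the value of the form [H] at [w = (1, e/2)] plus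
    an eighth of the trace of the lower block [H'].  The corner entry [b] is
    controlled by the parallelogram inequality, which is nonnegativity of the form
    at [(1, e)]: [b <= 2 w^T H w + e^T H' e / 2]; and [e^T H' e <= n^2 tr H'].
    Hence [tr H <= 2 w^T H w + (n^2 + 2) / 2 * tr H'], which explains the value of
    [slater_gap]. *)
Lemma slater_psd (H : 'M[R]_(1 + n)) : symmetric_mx H -> psd H ->
  slater_gap * \tr H <= mxdot slater_mx H.
Proof.
move=> H_sym H_psd.
have [b [h [H' [HE H'_sym]]]] := lift_mx_eta H_sym.
pose e : 'cV[R]_n := const_mx 1.
pose T := \tr H'; pose E := mxdot e (H' *m e).
have H'0 i : 0 <= H' i i.
  by have := psd_diag_ge0 H_psd (rshift 1 i); rewrite HE block_mxEdr.
have E_le : E <= n%:R ^+ 2 * T.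
  have H'psd : psd H'.
    apply/psdP => y; rewrite HE in H_psd; have := (psd_liftP _ _ _).1 H_psd 0 y.
    by rewrite expr0n !mulr0 mul0r !add0r.
  have -> : E = \sum_i \sum_j H' i j.
    rewrite /E mxdotE; apply: eq_bigr => i _; rewrite big_ord1 !mxE mul1r.
    by apply: eq_bigr => j _; rewrite mxE mulr1.
  have -> : n%:R ^+ 2 * T = \sum_(i < n) \sum_(j < n) T.
    by rewrite !sumr_const card_ord -mulrnA -[RHS]mulr_natl natrM expr2.
  do 2!(apply: ler_sum => ? _).
  exact: le_trans (ler_norm _) (psd_entry_le_trace H'_sym H'psd _ _).
have T0 : 0 <= T by apply: sumr_ge0.
have trE : \tr H = b + T by rewrite HE mxtrace_block mxtrace_scalar mulr1n.
have dotE : mxdot slater_mx H = b + mxdot h e + 4^-1 * E + 8^-1 * T.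
  rewrite HE mxdot_lift mul1r.
  have -> : const_mx 2^-1 = 2^-1 *: e by rewrite scalemx_const mulr1.
  rewrite mxdotZl (mxdotC e) mxdotDl.
  have -> : const_mx 4^-1 = 4^-1 *: (e *m e^T) :> 'M[R]_n.
    by apply/matrixP => i j; rewrite !mxE big_ord1 !mxE !mulr1.
  rewrite mxdotZl (mxdotC (e *m e^T)) mxdot_rank1 -mulmxA -mxdot_col -/E.
  by rewrite /mxdot tr_scalar_mx mul_scalar_mx mxtraceZ; field.
rewrite trE dotE.
rewrite HE in H_psd; have form s := (psd_liftP _ _ _).1 H_psd s e.
(* Four times the form at [w], then the form at [(1, e)]. *)
have := form 1; have := form 2; rewrite -/E => f2 f1.
have := slater_gap_gt0.
have gapE : slater_gap * (n%:R ^+ 2 + 2) = 4^-1.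
  by rewrite /slater_gap; field; rewrite gt_eqF // ltr_wpDl // sqr_ge0.
have gap8 : slater_gap <= 8^-1.
  by have := slater_gap_gt0; have := sqr_ge0 (n%:R : R); nra.
move=> g0.
have bT : b + T <= 2 * (b + mxdot h e + 4^-1 * E) + (n%:R ^+ 2 + 2) / 2 * T.
  by nra.
apply: le_trans (ler_wpM2l (ltW g0) bT) _.
rewrite mulrDr.
have -> : slater_gap * ((n%:R ^+ 2 + 2) / 2 * T) = 8^-1 * T.
  by rewrite !mulrA gapE; congr (_ * T); field.
by rewrite lerD2r; nra.
Qed.

End Relaxation.

(** * Complementary slackness and the algorithm *)

Section Complementarity.
Variables (R : realType) (n : nat).
Implicit Types (x c h y u v : 'cV[R]_n) (Q H X W Y Z : 'M[R]_n).

Lemma mem_idxBL x i : box x -> (i \in (idxB x :|: idxL x)%SET) = (1 - x i 0 != 0).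
Proof.
move=> /(_ i)/andP[x0 x1]; rewrite !inE subr_eq0 (eq_sym 1).
rewrite lt_def lt_neqAle x0 x1 !andbT.
by have [->|] := eqVneq (x i 0) 0; rewrite ?orbF //= eq_sym oner_eq0.
Qed.

Lemma mem_idxBU x i : box x -> (i \in (idxB x :|: idxU x)%SET) = (x i 0 != 0).
Proof.
move=> /(_ i)/andP[x0 x1]; rewrite !inE.
rewrite lt_def lt_neqAle x0 x1 !andbT.
by have [->|] := eqVneq (x i 0) 1; rewrite ?orbF ?andbT ?oner_eq0.
Qed.

(** The zero pattern of a multiplier is complementary slackness: its support
    avoids the positions where the slack [s] is nonzero. *)
Lemma mzero_on_ge0_offP (S : {set 'I_n * 'I_n}) (s : 'I_n -> 'I_n -> R) (A : 'M[R]_n) :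
  (forall i j, ((i, j) \in S) = (s i j != 0)) ->
  mzero_on_ge0_off S A <->
  (forall i j, 0 <= A i j) /\ (forall i j, A i j * s i j = 0).
Proof.
move=> S_s; split=> [A_S|[A0 As] i j].
  split=> i j; have := A_S i j; rewrite S_s; case: eqP => [s0|_] //= A0.
  - by rewrite A0.
  - by rewrite s0 mulr0.
  - by rewrite A0 mul0r.
rewrite S_s; case: eqP => [_|/eqP s0] //=.
by have /eqP := As i j; rewrite mulf_eq0 (negPf s0) orbF => /eqP.
Qed.

Lemma alg3_WP x W : box x ->
  mzero_on_ge0_off
    (finset.setX (idxB x :|: idxL x) (idxB x :|: idxL x))%SET W <->
  (forall i j, 0 <= W i j) /\
  (forall i j, W i j * ((1 - x i 0) * (1 - x j 0)) = 0).
Proof.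
move=> x_box; apply: mzero_on_ge0_offP => i j.
by rewrite finset.in_setX !mem_idxBL // mulf_eq0 negb_or.
Qed.

Lemma alg3_ZP x Z : box x ->
  mzero_on_ge0_off
    (finset.setX (idxB x :|: idxU x) (idxB x :|: idxU x))%SET Z <->
  (forall i j, 0 <= Z i j) /\ (forall i j, Z i j * (x i 0 * x j 0) = 0).
Proof.
move=> x_box; apply: mzero_on_ge0_offP => i j.
by rewrite finset.in_setX !mem_idxBU // mulf_eq0 negb_or.
Qed.

Lemma alg3_YP x Y : box x ->
  mzero_on_ge0_off
    (finset.setX (idxL x) (idxB x) :|: finset.setX (idxL x) (idxU x)
     :|: finset.setX (idxB x) (idxB x) :|: finset.setX (idxB x) (idxU x))%SET Y <->
  (forall i j, 0 <= Y i j) /\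
  (forall i j, Y i j * ((1 - x i 0) * x j 0) = 0).
Proof.
move=> x_box; apply: mzero_on_ge0_offP => i j.
rewrite mulf_eq0 negb_or -mem_idxBL // -mem_idxBU // !inE /=.
by case: (x i 0 == 0); case: (0 < x i 0 < 1); case: (0 < x j 0 < 1);
  case: (x j 0 == 1).
Qed.

Lemma mxdot_ge0_eq0 m k (L D : 'M[R]_(m, k)) :
  (forall i j, 0 <= L i j) -> (forall i j, 0 <= D i j) ->
  mxdot L D = 0 -> forall i j, L i j * D i j = 0.
Proof.
move=> L0 D0 /eqP; have LD0 i j : 0 <= L i j * D i j by exact: mulr_ge0.
rewrite mxdotE psumr_eq0 => [/allP LD i j|i _]; last exact: sumr_ge0.
have := LD i (mem_index_enum _); rewrite /= psumr_eq0 // => /allP LDi.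
exact/eqP/(LDi j (mem_index_enum _)).
Qed.

(** At a rank-one point the linearised products of bound factors are genuine
    products, so each RLT slack factors. *)
Lemma slack_rank1P x W Y Z :
  (forall i j, block_mx Z Y^T Y W i j *
     (facet_mx R n *m lift_mx 1 x (x *m x^T) *m (facet_mx R n)^T) i j = 0) <->
  [/\ forall i j, Z i j * (x i 0 * x j 0) = 0,
      forall i j, Y i j * ((1 - x i 0) * x j 0) = 0 &
      forall i j, W i j * ((1 - x i 0) * (1 - x j 0)) = 0].
Proof.
have xxE i j : (x *m x^T) i j = x i 0 * x j 0.
  by rewrite mxE big_ord1 [x^T _ _]mxE.
rewrite facet_congr; split=> [P0|[Z0 Y0 W0] i j].
  split=> i j.
  - by have := P0 (lshift n i) (lshift n j); rewrite !block_mxEul xxE.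
  - have := P0 (rshift n i) (lshift n j); rewrite !block_mxEdl mxE xxE => <-.
    by ring.
  - have := P0 (rshift n i) (rshift n j); rewrite !block_mxEdr mxE xxE => <-.
    by ring.
have [i' ->|i' ->] := split_ordP i; have [j' ->|j' ->] := split_ordP j;
  rewrite ?(block_mxEul, block_mxEur, block_mxEdl, block_mxEdr).
- by rewrite xxE.
- by rewrite 2!mxE xxE -(Y0 j' i'); ring.
- by rewrite mxE xxE -(Y0 i' j'); ring.
- by rewrite mxE xxE -(W0 i' j'); ring.
Qed.

(** The form of this matrix at [(s, y)] is the form of [H] at [y - s x]. *)
Lemma lift_psd_of_center x beta h H : symmetric_mx H -> psd H ->
  h = - (H *m x) -> beta = - mxdot h x ->
  psd (lift_mx beta h H).
Proof.
move=> H_sym H_psd hE ->; apply/psd_liftP => s y.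
have := (psdP H).1 H_psd (y - s *: x).
have xy : mxdot x (H *m y) = - mxdot h y.
  by rewrite hE mxdotNl opprK mxdot_sym.
have yx : mxdot y (H *m x) = - mxdot h y by rewrite -(mxdot_sym H_sym) mxdotC.
have xx : mxdot x (H *m x) = - mxdot h x.
  by rewrite hE mxdotNl opprK mxdotC.
rewrite mulmxBr -scalemxAr mxdotBl !mxdotBr !mxdotZl !mxdotZr xy yx xx.
by move=> form; lra.
Qed.

(** The certificate is nonnegative on the relaxation and zero at [x x^T], while
    [u] and [v] are supported where [x] is at its upper, respectively lower,
    bound. *)
Lemma algorithm3_sound x u v W Y Z beta h H :
  algorithm3_choice x u v W Y Z beta h H ->
  E_RS (algorithm3_Q W Y Z H, algorithm3_c u v W Y h).
Proof.
case=> x_box u_off v_off W_sym /(alg3_WP _ x_box)[W0 Wx].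
move=> /(alg3_YP _ x_box)[Y0 Yx] Z_sym /(alg3_ZP _ x_box)[Z0 Zx] H_sym H_psd hE bE.
rewrite -mxdot_col in bE.
set Q := algorithm3_Q _ _ _ _; set c := algorithm3_c _ _ _ _ _.
have Q_sym : symmetric_mx Q.
  rewrite /symmetric_mx /Q /algorithm3_Q !linearD !linearN /= trmxK W_sym Z_sym H_sym.
  by rewrite -!addrA; congr (_ + _); rewrite addrCA.
have optimal y X : F_RS (y, X) ->
    lifted_obj Q c (x, x *m x^T) <= lifted_obj Q c (y, X).
  move=> yX_F; have [X_sym X_psd X_rlt] := (F_RSP _ _).1 yX_F.
  pose c' := - (W *m ones R n) + Y^T *m ones R n + h.
  have dualE M : mxdot (lift_mx (mxdot (ones R n) (W *m ones R n) + beta) c' Q) M =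
      mxdot (block_mx Z Y^T Y W) (facet_mx R n *m M *m (facet_mx R n)^T)
      + mxdot (lift_mx beta h H) M.
    by rewrite -dual_lift // mxdotDl mxdot_congr.
  have Hb_psd := lift_psd_of_center H_sym H_psd hE bE.
  have at_y : 0 <= mxdot
      (lift_mx (mxdot (ones R n) (W *m ones R n) + beta) c' Q) (lift_mx 1 y X).
    rewrite dualE; apply: addr_ge0; last first.
      by apply: psd_mxdot_ge0 => //; exact: lift_mx_sym.
    rewrite mxdotE; apply: sumr_ge0 => i _; apply: sumr_ge0 => j _.
    apply: mulr_ge0; last exact: X_rlt.
    have [i' ->|i' ->] := split_ordP i; have [j' ->|j' ->] := split_ordP j;
      by rewrite ?(block_mxEul, block_mxEur, block_mxEdl, block_mxEdr) ?mxE.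
  have at_x : mxdot (lift_mx (mxdot (ones R n) (W *m ones R n) + beta) c' Q)
      (lift_mx 1 x (x *m x^T)) = 0.
    rewrite dualE mxdotE big1 ?add0r => [|i _]; last first.
      rewrite big1 // => j _.
      exact: ((slack_rank1P x W Y Z).2 (And3 Zx Yx Wx)).
    rewrite mxdot_lift mxdot_rank1 -mulmxA -mxdot_col bE.
    have -> : mxdot x (H *m x) = - mxdot h x.
      by rewrite hE mxdotNl opprK mxdotC.
    by ring.
  rewrite -lifted_objE in at_y; rewrite -lifted_objE in at_x.
  have objE p : lifted_obj Q c p =
      lifted_obj Q c' p - mxdot u p.1 + mxdot v p.1.
    rewrite /lifted_obj -!mxdot_col.
    have -> : c = c' - u + v.
      by apply/matrixP => i j; rewrite !mxE; ring.
    move: {dualE at_x at_y} c' => d.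
    by rewrite [mxdot (_ + v) _]mxdotDl [mxdot (d - u) _]mxdotBl; ring.
  have y_box : box y by have [[]] := yX_F.
  have uxy : mxdot u y <= mxdot u x.
    rewrite !mxdotE; apply: ler_sum => i _; rewrite !big_ord1.
    have := u_off i; have /andP[_ y1] := y_box i.
    rewrite finset.setUC mem_idxBL //.
    case: eqP => [x1 /= u0|_ /= ->]; last by rewrite !mul0r.
    by rewrite ler_wpM2l //; lra.
  have vxy : mxdot v x <= mxdot v y.
    rewrite !mxdotE; apply: ler_sum => i _; rewrite !big_ord1.
    have := v_off i; have /andP[y0 _] := y_box i.
    rewrite mem_idxBU //; case: eqP => [x1 /= v0|_ /= ->]; last by rewrite !mul0r.
    by rewrite ler_wpM2l //; lra.
  rewrite !objE /=; lra.
have RS_eq : ell_RS Q c = lifted_obj Q c (x, x *m x^T).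
  by apply: inf_image_attained => [|[y X]]; [exact: F_RS_rank1|exact: optimal].
split=> //=; rewrite RS_eq lifted_obj_rank1 //.
apply: inf_image_attained => // y y_box.
by rewrite -!lifted_obj_rank1 //; apply/optimal/F_RS_rank1.
Qed.

(** The multipliers of the bounds on [x] can be taken to be zero since the RLT
    inequalities imply these bounds. *)
Lemma algorithm3_complete Q c : E_RS (Q, c) ->
  exists x W Y Z beta h H,
    algorithm3 x 0 0 W Y Z beta h H (Q, c).
Proof.
move=> [/= Q_sym ell_eq].
have [x x_box [xE _]] := ell_star_min Q c.
have [_ _ [_ RS_le]] := ell_RS_min Q c.
have obj_x : box_qp_obj Q c x = ell_RS Q c by rewrite -xE.
have C_sym := lift_mx_sym (- 2 * ell_RS Q c) c Q_sym.
have [L [Hb [L_sym L0 Hb_sym Hb_psd CE]]] :=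
  sdp_farkas (slater_gap_gt0 R n) (@slater_rlt R n) (@slater_psd R n) C_sym
             (lifted_obj_ge0_on_cone RS_le).
pose Z := ulsubmx L; pose Y := dlsubmx L; pose W := drsubmx L.
have LE : L = block_mx Z Y^T Y W.
  rewrite /Y -{1}(submxK L); congr block_mx.
  by rewrite trmx_dlsub L_sym.
have W_sym : symmetric_mx W by rewrite /symmetric_mx trmx_drsub L_sym.
have Z_sym : symmetric_mx Z by rewrite /symmetric_mx trmx_ulsub L_sym.
have [beta [h [H [HbE H_sym]]]] := lift_mx_eta Hb_sym.
have [cE QE] : c = - (W *m ones R n) + Y^T *m ones R n + h /\ Q = algorithm3_Q W Y Z H.
  by move: CE; rewrite LE HbE dual_lift // => /lift_mx_inj.
have xx_F := F_RS_rank1 x_box; have [xx_sym xx_psd xx_rlt] := (F_RSP _ _).1 xx_F.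
have : mxdot (lift_mx (- 2 * ell_RS Q c) c Q) (lift_mx 1 x (x *m x^T)) = 0.
  by rewrite -lifted_objE lifted_obj_rank1 // obj_x; ring.
rewrite CE mxdotDl mxdot_congr => /eqP; rewrite paddr_eq0; last first.
- exact: psd_mxdot_ge0.
- by rewrite mxdotE; do 2!apply: sumr_ge0 => ? _; rewrite mulr_ge0.
case/andP=> /eqP L_slack /eqP Hb_slack.
have := mxdot_ge0_eq0 L0 xx_rlt L_slack; rewrite LE => /slack_rank1P[Zx Yx Wx].
have Hb_ker : Hb *m col_mx 1%:M x = 0.
  apply: psd_ker => //; move: Hb_slack.
  by rewrite lift_rank1 mxdot_rank1 -mulmxA -mxdot_col.
move: Hb_ker; rewrite HbE mul_block_col mul_mx_scalar mulmx1 scale1r.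
rewrite -[0]vsubmxK => /eq_col_mx[b0 h0].
rewrite linear0 in b0; rewrite linear0 in h0.
have W0 i j : 0 <= W i j by rewrite !mxE.
have Y0 i j : 0 <= Y i j by rewrite !mxE.
have Z0 i j : 0 <= Z i j by rewrite !mxE.
exists x, W, Y, Z, beta, h, H; split; last first.
  by rewrite QE /algorithm3_c cE oppr0 addr0 add0r.
split=> //.
- by move=> j; case: ifP; rewrite mxE.
- by move=> j; case: ifP; rewrite mxE.
- exact/alg3_WP.
- exact/alg3_YP.
- exact/alg3_ZP.
- apply/psdP => y; rewrite HbE in Hb_psd.
  by have := (psd_liftP _ _ _).1 Hb_psd 0 y; rewrite expr0n !mulr0 mul0r !add0r.
- by apply/eqP; rewrite -addr_eq0 h0.
- have := congr1 (fun M : 'M[R]_1 => M 0 0) b0; rewrite mxE [X in X + _]mxE eqxx mulr1n.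
  by rewrite [X in _ = X]mxE => /eqP; rewrite addr_eq0 => /eqP.
Qed.
End Complementarity.

Theorem proposition5p2 (R : realType) (n : nat) (hn : (1 <= n)%N) :
  (forall (x u v : 'cV[R]_n) (W Y Z : 'M[R]_n) (beta : R) (h : 'cV[R]_n)
          (H Q : 'M[R]_n) (c : 'cV[R]_n),
     algorithm3 x u v W Y Z beta h H (Q, c) -> E_RS (Q, c))
  /\
  (forall (Q : 'M[R]_n) (c : 'cV[R]_n),
     E_RS (Q, c) ->
     exists (x u v : 'cV[R]_n) (W Y Z : 'M[R]_n) (beta : R) (h : 'cV[R]_n)
            (H : 'M[R]_n),
       algorithm3 x u v W Y Z beta h H (Q, c)).
Proof.
split=> [x u v W Y Z beta h H Q c [choice [-> ->]]|Q c Qc_E].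
  exact: algorithm3_sound choice.
have [x [W [Y [Z [beta [h [H out]]]]]]] := algorithm3_complete Qc_E.
by exists x, 0, 0, W, Y, Z, beta, h, H.
Qed.
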